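(* If a discrete space $X$ admits a functorial $|X|$-Lindelöfification, then $|X|$ is measurable.
   Context: All topological spaces are assumed to be completely regular and Hausdorff, and $|X|$ denotes the cardinality of $X$. For a cardinal $\kappa$, a space $X$ is $\kappa$-Lindelöf if for every open covering $\mathcal{U}$ of $X$ there is a subset $\mathcal{V}\subset\mathcal{U}$ with $\bigcup\mathcal{V}=X$ and $|\mathcal{V}|<\kappa$. A space $X$ admits a functorial $\kappa$-Lindelöfification if there exist a $\kappa$-Lindelöf space $\nu X$ and a continuous map $i_X:X\to\nu X$ such that for every $\kappa$-Lindelöf space $Y$ and every continuous map $f:X\to Y$ there is a unique continuous map $\tilde f:\nu X\to Y$ with $f=\tilde f\circ i_X$. A filter $U$ on a set is $\kappa$-complete if $\bigcap U_0\in U$ for every family $U_0\subset U$ with $|U_0|<\kappa$. A cardinal $\kappa$ is measurable if $\kappa$ is uncountable and there exists a $\kappa$-complete nonprincipal ultrafilter on $\kappa$.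
   Formalization: The discrete space X is additionally assumed uncountable: for |X| = ℵ0 the Stone–Čech compactification, and for |X| = 2 the one-point space, is a functorial |X|-Lindelöfification although |X| is not measurable; for other countable |X| none exists. *)

(* Defs.v *)
From HB Require Import structures.
From mathcomp Require Import all_boot all_order all_algebra.
From mathcomp Require Import all_classical all_reals all_analysis.

Set Implicit Arguments.
Unset Strict Implicit.
Unset Printing Implicit Defensive.

Local Open Scope classical_set_scope.
Local Open Scope card_scope.

(* A cardinal kappa is represented by an arbitrary type K of cardinality kappa;
   every notion below depends on K only through its cardinality. *)

Definition card_lt (T U : Type) (A : set T) (B : set U) : Prop :=
  A #<= B /\ ~ (B #<= A).

Definition tychonoff_space (T : topologicalType) : Prop :=
  completely_regular_space T /\ hausdorff_space T.

Definition lindelof_card (K : Type) (T : topologicalType) : Prop :=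
  forall C : set (set T),
    (forall A, C A -> open A) -> \bigcup_(A in C) A = [set: T] ->
    exists D : set (set T),
      [/\ D `<=` C, \bigcup_(A in D) A = [set: T] & card_lt D [set: K]].

Definition functorial_lindelofification (K : Type) (X nuX : topologicalType)
    (i : X -> nuX) : Prop :=
  [/\ tychonoff_space nuX, lindelof_card K nuX, continuous i &
    forall (Y : topologicalType) (f : X -> Y),
      tychonoff_space Y -> lindelof_card K Y -> continuous f ->
      exists! g : nuX -> Y, continuous g /\ f = g \o i].

Definition admits_functorial_lindelofification (K : Type)
    (X : topologicalType) : Prop :=
  exists (nuX : topologicalType) (i : X -> nuX),
    functorial_lindelofification K i.

Definition complete_filter (K T : Type) (U : set_system T) : Prop :=
  forall U0 : set (set T),
    U0 `<=` U -> card_lt U0 [set: K] -> U (\bigcap_(A in U0) A).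

Definition nonprincipal (T : Type) (U : set_system T) : Prop :=
  forall x : T, U <> principal_filter x.

Definition measurable_cardinal (K : Type) : Prop :=
  ~ countable [set: K] /\
  exists U : set_system K,
    [/\ UltraFilter U, complete_filter K U & nonprincipal U].

(* Main.v *)
Require Import Defs.
From mathcomp Require Import all_boot all_order all_algebra.
From mathcomp Require Import all_classical all_reals all_analysis.

(** Write K for the cardinal and let [i : X -> nuX] be the functorial
    K-Lindelofification of the discrete space X.  Every discrete space with
    fewer than K points is Tychonoff and K-Lindelof, so a map from X to such a
    space extends uniquely along [i].

    Extending maps to the two-point space shows that every subset of X is the
    preimage of exactly one clopen subset of nuX ([clopen_extension],
    [clopen_preimage_inj]).  Hence for each point p of nuX the preimages of the
    clopen neighbourhoods of p form an ultrafilter on X, [clopen_trace i p].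

    Extending maps to an arbitrary small discrete space shows that this
    ultrafilter is K-complete: whenever X is partitioned into fewer than K
    pieces, the map onto the index space extends to nuX, and the piece indexed
    by the value at p belongs to the ultrafilter ([clopen_trace_fiber],
    [clopen_trace_complete]).

    Finally, nuX is itself an admissible target, so a continuous self-map of
    nuX fixing the image of [i] is the identity.  Applied to the map collapsing
    a clopen set onto one point, this shows that the clopen set tracing {x} is
    just {i x} ([clopen_over_point]).  It follows that the ultrafilter at p is
    nonprincipal as soon as p is outside the image of [i].  Such a p exists:
    otherwise nuX would be covered by the isolated points [i x], as many as
    there are points in X, and no proper subfamily would cover
    ([range_not_full]). *)

Local Open Scope classical_set_scope.

Lemma card_le_lt_trans {S T U : Type} (A : set S) (B : set T) (C : set U) :
  (A #<= B)%card -> card_lt B C -> card_lt A C.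
Proof.
move=> AB [BC nCB]; split; first exact: card_le_trans AB BC.
by move=> CA; apply: nCB; exact: card_le_trans CA AB.
Qed.

Lemma card_lt_finite_infinite {T U : Type} (A : set T) (B : set U) :
  finite_set A -> infinite_set B -> card_lt A B.
Proof.
move=> finA infB; split.
  by apply: card_le_trans (finite_set_countable finA) _; apply/infiniteP.
by move=> BA; apply: infB; exact: card_le_finite BA finA.
Qed.

(** Complete regularity is witnessed by the discrete uniformity, for which the
    diagonal is an entourage. *)
Lemma tychonoff_discrete (D : discreteTopologicalType) : tychonoff_space D.
Proof.
split.
  move=> a B _ nBa.
  exists (Uniform.class (discrete_topology D)), (range (fun x : D => (x, x))).
  split.
  - by move=> z zd; exact: zd.
  - rewrite -subset0 => -[u v] [/= [-> Bv] [w _ [wa wv]]].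
    by case: nBa; rewrite -wa wv.
  - by move=> x A; rewrite !nbhs_principalE.
move=> x y xy.
by have [z [/= -> ->]] := xy _ _ (discrete_set1 x) (discrete_set1 y).
Qed.

(** Choosing one member of the cover around each point already gives a subcover
    with at most as many members as there are points. *)
Lemma lindelof_card_discrete (K : Type) (D : discreteTopologicalType) :
  card_lt [set: D] [set: K] -> lindelof_card K D.
Proof.
move=> ltDK C _ covC.
have pick_cover (d : D) : exists A, C A /\ A d.
  by have : [set: D] d by []; rewrite -covC => -[A CA Ad]; exists A.
pose c d := sval (cid (pick_cover d)).
have cP d : C (c d) /\ c d d := svalP (cid (pick_cover d)).
exists (range c); split.
- by move=> _ [d _ <-]; exact: (cP d).1.
- by rewrite -subTset => d _; exists (c d); [exists d|exact: (cP d).2].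
- exact: card_le_lt_trans (card_image_le _ _) ltDK.
Qed.

Lemma continuous_if_clopen {S T : topologicalType} (V : set S) (a b : S -> T) :
  clopen V -> continuous a -> continuous b ->
  continuous (fun y => if y \in V then a y else b y).
Proof.
move=> [oV cV] ca cb y A.
have [yV|/negP yV] := boolP (y \in V) => nA.
  have nV : nbhs y V by apply: open_nbhs_nbhs; split => //; exact: set_mem.
  by apply: filterS2 nV (ca y A nA) => z Vz /= aA; rewrite mem_set.
have nV : nbhs y (~` V).
  apply: open_nbhs_nbhs; split; first exact: closed_openC.
  by move=> Vy; apply: yV; exact: mem_set.
by apply: filterS2 nV (cb y A nA) => z Vz /= bA; rewrite memNset.
Qed.

(** Defined through clopen sets of [Y] so that, once every subset of [X] is the
    preimage of a unique clopen set, stability under intersections and the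
    dichotomy between a set and its complement are inherited from [Y]. *)
Definition clopen_trace {X Y : topologicalType} (i : X -> Y) (p : Y)
    : set_system X :=
  [set A | exists V, [/\ clopen V, i @^-1` V = A & V p]].

Section LindelofificationOfDiscrete.
Context {K : Type} {X : discreteTopologicalType} {nuX : topologicalType}.
Variable i : X -> nuX.
Hypothesis infK : infinite_set [set: K].
Hypothesis lindX : functorial_lindelofification K i.

Lemma extend_to_small_discrete (D : discreteTopologicalType) (f : X -> D) :
  card_lt [set: D] [set: K] -> exists! g : nuX -> D, continuous g /\ f = g \o i.
Proof.
move=> ltDK; have [_ _ _ ext] := lindX.
apply: ext; [exact: tychonoff_discrete|exact: lindelof_card_discrete|].
by move=> x A; rewrite nbhs_principalE => /principal_filterP fA;
  rewrite nbhs_principalE; apply/principal_filterP.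
Qed.

Lemma card_lt_bool : card_lt [set: bool] [set: K].
Proof. by apply: card_lt_finite_infinite. Qed.

Lemma clopen_preimage_discrete (D : discreteTopologicalType) (g : nuX -> D)
  (S : set D) : continuous g -> clopen (g @^-1` S).
Proof.
move=> cg; split.
  by move/continuousP : cg; apply; exact: discrete_open.
by apply: preimage_closed => [y _|]; [exact: cg|exact: discrete_closed].
Qed.

Lemma clopen_extension (A : set X) : exists2 V, clopen V & i @^-1` V = A.
Proof.
have [g [[cg fg] _]] :=
  extend_to_small_discrete bool (fun x => x \in A) card_lt_bool.
exists (g @^-1` [set true]); first exact: clopen_preimage_discrete.
apply/seteqP; split => x /=.
  by rewrite -[g (i x)]/((g \o i) x) -fg => /set_mem.
by move=> Ax; rewrite -[g (i x)]/((g \o i) x) -fg mem_set.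
Qed.

(** Both characteristic functions extend the same two-valued map on [X]. *)
Lemma clopen_preimage_inj (V W : set nuX) :
  clopen V -> clopen W -> i @^-1` V = i @^-1` W -> V = W.
Proof.
move=> cV cW iVW.
have cchi (Z : set nuX) : clopen Z -> continuous (fun y => y \in Z).
  move=> cZ.
  have -> : (fun y => y \in Z) = (fun y => if y \in Z then true else false).
    by apply/funext => y; case: (y \in Z).
  by apply: continuous_if_clopen => // y; exact: cvg_cst.
have [g [_ guniq]] :=
  extend_to_small_discrete bool (fun x => i x \in V) card_lt_bool.
have gV := guniq _ (conj (cchi _ cV) erefl).
have gW : g = (fun y => y \in W).
  apply: guniq; split; first exact: cchi.
  by apply/funext => x /=; apply/idP/idP => /set_mem h; apply/mem_set;
    [have : (i @^-1` V) x by []|have : (i @^-1` W) x by []];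
    rewrite ?iVW // -iVW.
apply/seteqP; split => y /mem_set.
  by rewrite -[y \in V]/((fun y => y \in V) y) -gV gW => /set_mem.
by rewrite -[y \in W]/((fun y => y \in W) y) -gW gV => /set_mem.
Qed.

Lemma clopen_tracePn (p : nuX) (A : set X) :
  clopen_trace i p (~` A) <-> ~ clopen_trace i p A.
Proof.
split.
  move=> [V [cV iV Vp]] [W [cW iW Wp]].
  have WC : clopen (~` W).
    by split; [exact: closed_openC cW.2|exact: open_closedC cW.1].
  suff VW : V = ~` W by move: Vp; rewrite VW.
  by apply: clopen_preimage_inj; rewrite ?iV -?preimage_setC ?iW.
have [V cV iV] := clopen_extension A => nA.
exists (~` V); split.
- by split; [exact: closed_openC cV.2|exact: open_closedC cV.1].
- by rewrite -preimage_setC iV.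
- by move=> Vp; apply: nA; exists V.
Qed.

Lemma clopen_traceI (p : nuX) (A B : set X) :
  clopen_trace i p A -> clopen_trace i p B -> clopen_trace i p (A `&` B).
Proof.
move=> [V [cV iV Vp]] [W [cW iW Wp]]; exists (V `&` W); split => //.
  by split; [exact: openI cV.1 cW.1|exact: closedI cV.2 cW.2].
by rewrite preimage_setI iV iW.
Qed.

Lemma clopen_traceT (p : nuX) : clopen_trace i p setT.
Proof. by exists setT; split => //; split; [exact: openT|exact: closedT]. Qed.

Lemma clopen_trace0 (p : nuX) : ~ clopen_trace i p set0.
Proof. by apply/clopen_tracePn; rewrite setC0; exact: clopen_traceT. Qed.

Lemma clopen_traceS (p : nuX) (A B : set X) :
  A `<=` B -> clopen_trace i p A -> clopen_trace i p B.
Proof.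
move=> AB UA; apply: contrapT => /clopen_tracePn UnB.
apply: (@clopen_trace0 p); rewrite -(_ : A `&` ~` B = set0).
  exact: clopen_traceI.
by apply/disjoints_subset; rewrite setCK.
Qed.

Lemma clopen_trace_ultra (p : nuX) : UltraFilter (clopen_trace i p).
Proof.
have PF : ProperFilter (clopen_trace i p).
  split; first exact: clopen_trace0.
  by split; [exact: clopen_traceT|exact: clopen_traceI|exact: clopen_traceS].
split => // G PG UG; apply/seteqP; split => // A GA.
apply: contrapT => /clopen_tracePn /UG GnA.
by apply: (@filter_not_empty _ G); rewrite -(setICr A); exact: filterI.
Qed.

(** The index [d] is the value at [p] of the extension of [f]: the fibre of the
    extension over that value is a clopen neighbourhood of [p]. *)
Lemma clopen_trace_fiber (D : discreteTopologicalType) (f : X -> D) (p : nuX) :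
  card_lt [set: D] [set: K] -> exists d, clopen_trace i p (f @^-1` [set d]).
Proof.
move=> ltDK; have [g [[cg fg] _]] := extend_to_small_discrete D f ltDK.
exists (g p), (g @^-1` [set g p]); split => //; last by rewrite fg.
exact: clopen_preimage_discrete.
Qed.

(** If the intersection of U0 were not in the ultrafilter, its complement would
    be.  Send each point x of that complement to a member of U0 missing x.  One
    fibre of this map is in the ultrafilter; on the complement it is disjoint
    from its index, which is itself in the ultrafilter. *)
Lemma clopen_trace_complete (p : nuX) : complete_filter K (clopen_trace i p).
Proof.
move=> U0 U0U ltU0; apply: contrapT => /clopen_tracePn Ucap.
have [[A0 UA0]|U00] := pselect (U0 !=set0); last first.
  apply: (@clopen_trace0 p); move: Ucap.
  rewrite (_ : U0 = set0) ?bigcap_set0 ?setCT //.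
  by apply/eqP/negP => /negP /set0P.
pose D : discreteTopologicalType := discrete_topology (set_type U0).
(* Points of the intersection are missed by no member of U0: A0 is their
   default. *)
have missed (x : X) : exists A : set_type U0,
    (~` \bigcap_(A in U0) A) x -> ~ val A x.
  have [|nx] := pselect ((~` \bigcap_(A in U0) A) x); last first.
    by exists (SigSub (mem_set UA0)).
  by rewrite setC_bigcap => -[A UA nAx]; exists (SigSub (mem_set UA)).
pose f x : D := sval (cid (missed x)).
have fP x : (~` \bigcap_(A in U0) A) x -> ~ val (f x : set_type U0) x :=
  svalP (cid (missed x)).
have ltD : card_lt [set: D] [set: K].
  apply: card_le_lt_trans ltU0.
  by have /card_eqPle [] := card_setT U0.
have [d Ud] := clopen_trace_fiber D f p ltD.
have UA : clopen_trace i p (val (d : set_type U0)).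
  by apply: U0U; exact: set_mem (valP (d : set_type U0)).
apply: (@clopen_trace0 p).
rewrite -(_ : f @^-1` [set d] `&` ~` (\bigcap_(A in U0) A)
              `&` val (d : set_type U0) = set0).
  by apply: clopen_traceI => //; exact: clopen_traceI.
by rewrite -subset0 => x [[/= fx /fP]]; rewrite fx.
Qed.

(** Collapsing V onto the point [i x] is a continuous self-map of [nuX] that
    fixes the image of [i], hence is the identity. *)
Lemma clopen_over_point (x : X) (V : set nuX) :
  clopen V -> i @^-1` V = [set x] -> V = [set i x].
Proof.
move=> cV iV; have [tych lind ci ext] := lindX.
have [h [_ huniq]] := ext nuX i tych lind ci.
have hid : h = @id nuX by apply: huniq; split=> // y.
have hr : h = (fun y => if y \in V then i x else y).
  apply: huniq; split.
    apply: continuous_if_clopen => // y; last exact: cvg_id.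
    exact: cvg_cst.
  apply/funext => y /=; case: ifPn => // /set_mem.
  by move=> Viy; have : (i @^-1` V) y by []; rewrite iV /= => ->.
apply/seteqP; split => [y Vy|_ ->].
  by rewrite -[y]/(id y) -hid hr mem_set.
by have : (i @^-1` V) x by rewrite iV.
Qed.

(** In particular [i] is injective with isolated values. *)
Lemma clopen_image_point (x : X) :
  clopen [set i x] /\ i @^-1` [set i x] = [set x].
Proof.
by have [V cV iV] := clopen_extension [set x]; rewrite -(clopen_over_point x V).
Qed.

Lemma clopen_trace_nonprincipal (p : nuX) :
  ~ range i p -> nonprincipal (clopen_trace i p).
Proof.
move=> nip x Ux; apply: nip.
have : clopen_trace i p [set x] by rewrite Ux; apply/principal_filterP.
by move=> [V [cV iV]]; rewrite (clopen_over_point x V) // => ->; exists x.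
Qed.

(** If [i] were onto, the singletons of [nuX] would form an open cover indexed
    injectively by [X], all of whose members are needed. *)
Lemma range_not_full : ([set: K] #<= [set: X])%card -> exists p, ~ range i p.
Proof.
move=> leKX; apply: contrapT => /forallNP surj.
have {}surj p : range i p by apply: contrapT; exact: surj.
have [_ lind _ _] := lindX.
pose pt x : set nuX := [set i x].
have opt A : range pt A -> open A.
  by move=> [x _ <-]; exact: (clopen_image_point x).1.1.
have covpt : \bigcup_(A in range pt) A = [set: nuX].
  by rewrite -subTset => p _; have [x _ <-] := surj p; exists (pt x) => //; exists x.
have [E [EC Ecov [_]]] := lind _ opt covpt; apply.
apply: card_le_trans leKX _.
have injpt : {in [set: X] &, injective pt}.
  move=> x y _ _ pxy; have : (i @^-1` pt x) y by rewrite pxy.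
  by rewrite (clopen_image_point x).2.
have /card_eqPle [_] := inj_card_eq injpt.
move=> /card_le_trans; apply; apply: subset_card_le => _ [x _ <-].
have : [set: nuX] (i x) by []; rewrite -Ecov => -[A EA Aix].
by have [y _ ptA] := EC A EA; move: Aix EA; rewrite -ptA /pt /= => ->.
Qed.

End LindelofificationOfDiscrete.

Theorem corollary4p9 (X : discreteTopologicalType)
    (hX : ~ countable [set: X]) :
  admits_functorial_lindelofification X X -> measurable_cardinal X.
Proof.
move=> [nuX [i lindX]]; split=> //.
have infX : infinite_set [set: X] by move=> /finite_set_countable.
have [p nip] := range_not_full i infX lindX (card_lexx _).
exists (clopen_trace i p); split.
- exact: clopen_trace_ultra infX lindX p.
- exact: clopen_trace_complete infX lindX p.
- exact: clopen_trace_nonprincipal lindX p nip.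
Qed.
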